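(* Let $\{\eta_k\}$ be an $N$-periodic binary sequence such that $\rho(\bar A_{N-1}\cdots\bar A_0)<1$ and $\rho(\tilde A_{N-1}\cdots\tilde A_0)<1$. Let $X\subseteq\mathbb{R}^{n_x}$ be the (measurable) constraint set, let $0<\delta<1$, and put $\alpha_x=\sqrt{n_x/\delta}$. Let $\mu_{x,k}^{\rm s}$ and $P_{x,k}^{\rm s}$ be the $N$-periodic steady-state mean and covariance matrix of the state (defined in the context), with each $P_{x,k}^{\rm s}$ invertible. Suppose that for $k=0,1,\dots,N-1$, $$\mu_{x,k}^{\rm s}\in X\sim\mathcal{E}\left(\mathbf{0},\frac{1}{\alpha_x^2}(P_{x,k}^{\rm s})^{-1}\right).$$ Then, in steady-state, the chance constraint holds: if $x_k$ is in steady-state, i.e., $x_k$ has mean $\mu_{x,k}^{\rm s}$ and covariance matrix $P_{x,k}^{\rm s}$ for all $k\ge k^*$, then $$\mathrm{Prob}(\{x_k\in X\})\ge1-\delta\quad\text{for all }k\ge k^*.$$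
   Context: Let $A\in\mathbb{R}^{n_x\times n_x}$, $B\in\mathbb{R}^{n_x\times m}$, $C\in\mathbb{R}^{p\times n_x}$, $K\in\mathbb{R}^{m\times n_x}$, $L\in\mathbb{R}^{n_x\times p}$, $u_T\in\mathbb{R}^m$. For an $N$-periodic binary sequence $\{\eta_k\}_{k\ge0}$ ($\eta_k\in\{0,1\}$, $\eta_{k+N}=\eta_k$), put $\bar A_k=A+\eta_kBK$ and $\tilde A_k=A+(1-\eta_k)LC$. The state $x_k$ and estimation error $e_k$ evolve as $$x_{k+1}=\bar A_kx_k-\eta_kBKe_k+\eta_kBu_T+w_k,\qquad e_{k+1}=\tilde A_ke_k+w_k+(1-\eta_k)L\nu_k,$$ where $\{w_k\}$ and $\{\nu_k\}$ are zero-mean, i.i.d. and mutually independent random sequences with covariances $\Sigma_w$, $\Sigma_\nu$ (no assumption is made on their distributions). The steady-state mean $\{\mu_{x,k}^{\rm s}\}$ is the unique $N$-periodic solution of $\mu_{x,k+1}=\bar A_k\mu_{x,k}+\eta_kBu_T$. The steady-state covariance is $P_{x,k}^{\rm s}=\begin{bmatrix}\mathbf{I}&\mathbf{0}\end{bmatrix}\breve P_k^{\rm s}\begin{bmatrix}\mathbf{I}&\mathbf{0}\end{bmatrix}^{\rm T}$, where $\{\breve P_k^{\rm s}\}$ is the unique $N$-periodic solution of $$\breve P_{k+1}=\breve A_k\breve P_k\breve A_k^{\rm T}+\breve\Gamma_k\begin{bmatrix}\Sigma_\nu&\mathbf{0}\\ \mathbf{0}&\Sigma_w\end{bmatrix}\breve\Gamma_k^{\rm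 T},\qquad \breve A_k=\begin{bmatrix}\bar A_k&-\eta_kBK\\ \mathbf{0}&\tilde A_k\end{bmatrix},\quad \breve\Gamma_k=\begin{bmatrix}\mathbf{0}&\mathbf{I}\\(1-\eta_k)L&\mathbf{I}\end{bmatrix}.$$ (This is the covariance recursion of $z_k=[x_k^{\rm T}\ e_k^{\rm T}]^{\rm T}$.) Notation: $\mathcal{E}(\mathbf{0},S)=\{x:\ x^{\rm T}Sx\le1\}$; $\sim$ denotes the Pontryagin set difference, $X\sim Y=\{x:\ x+y\in X\ \text{for all } y\in Y\}$; $\rho(\cdot)$ is the spectral radius. *)

(* Defs.v *)
(* MathComp / MathComp-Analysis, over an abstract [R : realType]. *)
From HB Require Import structures.
From mathcomp Require Import all_boot all_order all_algebra.
From mathcomp Require Import finmap.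
From mathcomp Require Import all_classical all_reals all_analysis.
From mathcomp Require Import complex.

Set Implicit Arguments.
Unset Strict Implicit.
Unset Printing Implicit Defensive.

Import Order.TTheory GRing.Theory Num.Theory.
Import numFieldNormedType.Exports.

Local Open Scope classical_set_scope.
Local Open Scope ring_scope.

(* The eigenvalues are the complex ones; for [n = 0] the set is empty and
   [sup] gives 0. *)
Definition spectral_radius (R : realType) (n : nat) (A : 'M[R]_n) : R :=
  sup [set r : R | exists2 z : R[i],
    eigenvalue (map_mx (real_complex R) A) z & r = ComplexField.Normc.normc z].

Definition periodic_seq (T : Type) (N : nat) (f : nat -> T) : Prop :=
  forall k, f (k + N)%N = f k.

(* M_{N-1} * ... * M_1 * M_0, latest factor on the left. *)
Fixpoint monodromy (R : realType) (n : nat) (M : nat -> 'M[R]_n) (N : nat)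
    : 'M[R]_n :=
  if N is k.+1 then M k *m monodromy M k else 1%:M.

Definition Abar (R : realType) (nx m : nat) (A : 'M[R]_nx)
    (B : 'M[R]_(nx, m)) (K : 'M[R]_(m, nx)) (eta : nat -> bool) (k : nat)
    : 'M[R]_nx :=
  A + (eta k)%:R *: (B *m K).

Definition Atilde (R : realType) (nx p : nat) (A : 'M[R]_nx)
    (L : 'M[R]_(nx, p)) (C : 'M[R]_(p, nx)) (eta : nat -> bool) (k : nat)
    : 'M[R]_nx :=
  A + (1 - (eta k)%:R) *: (L *m C).

Definition Abreve (R : realType) (nx m p : nat) (A : 'M[R]_nx)
    (B : 'M[R]_(nx, m)) (C : 'M[R]_(p, nx)) (K : 'M[R]_(m, nx))
    (L : 'M[R]_(nx, p)) (eta : nat -> bool) (k : nat) : 'M[R]_(nx + nx) :=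
  block_mx (Abar A B K eta k) (- ((eta k)%:R *: (B *m K)))
           0                  (Atilde A L C eta k).

Definition Gammabreve (R : realType) (nx p : nat) (L : 'M[R]_(nx, p))
    (eta : nat -> bool) (k : nat) : 'M[R]_(nx + nx, p + nx) :=
  block_mx 0                            1%:M
           ((1 - (eta k)%:R) *: L)      1%:M.

(* Uniqueness of the periodic solutions below is not part of the predicates: it
   follows from the spectral radius conditions on the two monodromy matrices. *)
Definition steady_mean (R : realType) (nx m : nat) (A : 'M[R]_nx)
    (B : 'M[R]_(nx, m)) (K : 'M[R]_(m, nx)) (uT : 'cV[R]_m) (N : nat)
    (eta : nat -> bool) (mu : nat -> 'cV[R]_nx) : Prop :=
  periodic_seq N mu /\
  forall k, mu k.+1 = Abar A B K eta k *m mu k + (eta k)%:R *: (B *m uT).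

Definition steady_joint_cov (R : realType) (nx m p : nat) (A : 'M[R]_nx)
    (B : 'M[R]_(nx, m)) (C : 'M[R]_(p, nx)) (K : 'M[R]_(m, nx))
    (L : 'M[R]_(nx, p)) (Sw : 'M[R]_nx) (Snu : 'M[R]_p) (N : nat)
    (eta : nat -> bool) (Pb : nat -> 'M[R]_(nx + nx)) : Prop :=
  periodic_seq N Pb /\
  forall k, Pb k.+1 =
    Abreve A B C K L eta k *m Pb k *m (Abreve A B C K L eta k)^T +
    Gammabreve L eta k *m block_mx Snu 0 0 Sw *m (Gammabreve L eta k)^T.

Definition state_cov (R : realType) (nx : nat) (Pb : nat -> 'M[R]_(nx + nx))
    (k : nat) : 'M[R]_nx :=
  row_mx 1%:M 0 *m Pb k *m (row_mx 1%:M 0)^T.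

Definition ellipsoid (R : realType) (n : nat) (S : 'M[R]_n)
    : set 'cV[R]_n :=
  [set x | (x^T *m S *m x) 0 0 <= 1].

Definition pontryagin_diff (R : realType) (n : nat) (X Y : set 'cV[R]_n)
    : set 'cV[R]_n :=
  [set x | forall y, Y y -> X (x + y)].

(* R^n with its Borel sigma-algebra. *)
Notation borel_cV R n := (g_sigma_algebraType (@open 'cV[R]_n)).

Definition coordinate (R : realType) (T : Type) (n : nat) (X : T -> 'cV[R]_n)
    (i : 'I_n) : T -> R :=
  fun t => X t i 0.

Definition has_mean (R : realType) (d : measure_display)
    (T : measurableType d) (P : probability T R) (n : nat)
    (X : T -> 'cV[R]_n) (mu : 'cV[R]_n) : Prop :=
  forall i, coordinate X i \in Lfun P 1%:E /\ 'E_P[coordinate X i]%E = (mu i 0)%:E.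

Definition has_cov (R : realType) (d : measure_display)
    (T : measurableType d) (P : probability T R) (n : nat)
    (X : T -> 'cV[R]_n) (S : 'M[R]_n) : Prop :=
  (forall i, coordinate X i \in Lfun P 2%:E) /\
  (forall i j, covariance P (coordinate X i) (coordinate X j) = (S i j)%:E).

Definition identically_distributed (R : realType) (d : measure_display)
    (T : measurableType d) (P : probability T R) (n : nat)
    (X : nat -> {RV P >-> borel_cV R n}) : Prop :=
  forall k (U : set (borel_cV R n)), measurable U ->
    distribution P (X k) U = distribution P (X 0%N) U.

Definition independent_systems (R : realType) (d : measure_display)
    (T : measurableType d) (P : probability T R) (I : choiceType)
    (G : I -> set (set T)) : Prop :=
  forall (J : {fset I}) (E : I -> set T), (forall i, i \in J -> G i (E i)) ->
    P (\bigcap_(i in [set` J]) E i) = (\prod_(i <- J) P (E i))%E.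

Definition generated_by (R : realType) (d : measure_display)
    (T : measurableType d) (P : probability T R) (n : nat)
    (X : {RV P >-> borel_cV R n}) : set (set T) :=
  [set X @^-1` U | U in (measurable : set (set (borel_cV R n)))].

(* Joint independence of w_0, w_1, ..., nu_0, nu_1, ...: this is independence
   within each sequence together with independence of the two sequences. *)
Definition independent_noises (R : realType) (d : measure_display)
    (T : measurableType d) (P : probability T R) (n p : nat)
    (w : nat -> {RV P >-> borel_cV R n})
    (nu : nat -> {RV P >-> borel_cV R p}) : Prop :=
  independent_systems P (fun i : nat + nat =>
    match i with inl k => generated_by (w k) | inr k => generated_by (nu k) end).

Definition closed_loop (R : realType) (d : measure_display)
    (T : measurableType d) (P : probability T R) (nx m p : nat)
    (A : 'M[R]_nx) (B : 'M[R]_(nx, m)) (C : 'M[R]_(p, nx))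
    (K : 'M[R]_(m, nx)) (L : 'M[R]_(nx, p)) (uT : 'cV[R]_m)
    (eta : nat -> bool)
    (w : nat -> {RV P >-> borel_cV R nx}) (nu : nat -> {RV P >-> borel_cV R p})
    (x e : nat -> {RV P >-> borel_cV R nx}) : Prop :=
  forall k (t : T),
    (x k.+1 t = Abar A B K eta k *m x k t - (eta k)%:R *: (B *m K *m e k t)
                + (eta k)%:R *: (B *m uT) + w k t :> 'cV[R]_nx) /\
    (e k.+1 t = Atilde A L C eta k *m e k t + w k t
                + (1 - (eta k)%:R) *: (L *m nu k t) :> 'cV[R]_nx).

(* Main.v *)
Require Import Defs.
From HB Require Import structures.
From mathcomp Require Import all_boot all_order all_algebra.
From mathcomp Require Import finmap.
From mathcomp Require Import all_classical all_reals all_analysis.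
From mathcomp Require Import complex.
From mathcomp Require Import measurable_realfun ring.

Import Order.TTheory GRing.Theory Num.Theory.
Import numFieldNormedType.Exports.

Local Open Scope classical_set_scope.
Local Open Scope ring_scope.

(** The conclusion is a multivariate Chebyshev inequality, free of any
    assumption on the distributions. If a random vector [Y] has mean [mu] and
    invertible covariance matrix [S], the nonnegative random variable
    [Q = (Y - mu)^T S^-1 (Y - mu)] has expectation [tr (S^-1 S) = n]
    ([expectation_centered_form]), so Markov's inequality gives
    [P (c Q > 1) <= c n] for every [c >= 0] ([multivariate_chebyshev]).

    With [c = 1 / alpha^2 = delta / n], where [n = nx], this says that [x_k - mu_k] lies in the
    ellipsoid of the hypothesis with probability at least [1 - delta]. On that
    event [x_k = mu_k + (x_k - mu_k)] belongs to [X], by definition of the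
    Pontryagin difference. The hypothesis covers one period only; it extends to
    every time because the steady-state mean and covariance are periodic. *)

Definition centered_form {R : realType} {T : Type} {n : nat} (M : 'M[R]_n)
    (X : T -> 'cV[R]_n) (mu : 'cV[R]_n) : T -> R :=
  fun t => ((X t - mu)^T *m M *m (X t - mu)) 0 0.

Lemma cov_sym {R : realType} {d : measure_display}
    {T : measurableType d} {P : probability T R} {n : nat}
    {X : T -> 'cV[R]_n} {S : 'M[R]_n} : has_cov P X S -> S^T = S.
Proof.
move=> [_ covX]; apply/matrixP => i j; rewrite mxE; apply/EFin_inj.
by rewrite -!covX covarianceC.
Qed.

(** The quadratic form is a linear combination, with the entries of [M] as
    coefficients, of products of two centered coordinates; such a product is
    integrable because both factors are square integrable, and its expectation
    is an entry of [S]. *)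
Lemma expectation_centered_form {R : realType} {d : measure_display}
    {T : measurableType d} {P : probability T R} {n : nat}
    {X : T -> 'cV[R]_n} {mu : 'cV[R]_n} {S : 'M[R]_n} (M : 'M[R]_n) :
    has_mean P X mu -> has_cov P X S ->
  centered_form M X mu \in Lfun P 1 /\
  'E_P[centered_form M X mu]%E = (\tr (M *m S))%:E.
Proof.
move=> meanX covX; have symS := cov_sym covX; have [L2X covXE] := covX.
pose Y (i : 'I_n) : T -> R := coordinate X i \- cst (mu i 0).
have L2Y i : Y i \in Lfun P 2%:E.
  (* The closure of [Lfun P 2] under addition takes a proof of [1 <= 2], which
     [rpredD] leaves as a side condition. *)
  rewrite /Y -[_ \- _]/(coordinate X i \+ (\- cst (mu i 0))).
  by rewrite rpredD ?lee1n// => le12; rewrite rpredN Lfun_cst.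
have L1YY i j : Y i \* Y j \in Lfun P 1 by exact: Lfun2_mul_Lfun1.
pose F (ij : 'I_n * 'I_n) : T -> R := M ij.1 ij.2 \o* (Y ij.1 \* Y ij.2).
have L1F ij : F ij \in Lfun P 1 by exact: Lfun_scale.
have EF ij : ('E_P[F ij] = (M ij.1 ij.2 * S ij.2 ij.1)%:E)%E.
  rewrite expectationZl// EFinM; congr (_ * _)%E.
  rewrite -symS mxE -covXE covariance.unlock.
  by rewrite (meanX ij.1).2 (meanX ij.2).2.
have -> : centered_form M X mu = \sum_ij F ij.
  apply/funext => t; rewrite fct_sumE /centered_form mxE.
  under eq_bigr do rewrite mxE big_distrl.
  rewrite exchange_big pair_big /=; apply: eq_bigr => -[i j] _.
  by rewrite /F /Y /coordinate !mxE /=; ring.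
split; first by rewrite rpred_sum.
rewrite -(big_map F xpredT id) expectation_sum; last first.
  by move=> _ /mapP[ij _ ->].
rewrite big_map; under eq_bigr do rewrite EF.
rewrite sumEFin /mxtrace; congr EFin.
under [RHS]eq_bigr do rewrite mxE.
by rewrite pair_big.
Qed.

(** The form [v^T S v] is the expectation of the square of [v^T (X - mu)], since
    this square is the centered form of the rank-one matrix [v v^T], and
    [tr (v v^T S) = v^T S v]. *)
Lemma cov_psd {R : realType} {d : measure_display}
    {T : measurableType d} {P : probability T R} {n : nat}
    {X : T -> 'cV[R]_n} {mu : 'cV[R]_n} {S : 'M[R]_n} (v : 'cV[R]_n) :
    has_mean P X mu -> has_cov P X S -> 0 <= (v^T *m S *m v) 0 0.
Proof.
move=> meanX covX.
have [_] := expectation_centered_form (v *m v^T) meanX covX.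
rewrite -mulmxA mxtrace_mulC trace_mx11 => EvX.
rewrite -lee_fin -EvX; apply: expectation_ge0 => t.
rewrite /centered_form mulmxA -mulmxA mxE big_ord1.
rewrite -[v^T *m _]trmxK trmx_mul trmxK [X in _ * X]mxE -expr2.
exact: sqr_ge0.
Qed.

(** As [S] is symmetric, [y^T S^-1 y = v^T S v] for [v = S^-1 y]. *)
Lemma invmx_cov_psd {R : realType} {d : measure_display}
    {T : measurableType d} {P : probability T R} {n : nat}
    {X : T -> 'cV[R]_n} {mu : 'cV[R]_n} {S : 'M[R]_n} (y : 'cV[R]_n) :
    has_mean P X mu -> has_cov P X S -> S \in unitmx ->
  0 <= (y^T *m invmx S *m y) 0 0.
Proof.
move=> meanX covX Sunit.
have := cov_psd (invmx S *m y) meanX covX.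
by rewrite trmx_mul trmx_inv (cov_sym covX) -!mulmxA mulKVmx.
Qed.

(** Outside [A] the nonnegative form [Q] of [c S^-1] exceeds 1, so the indicator
    of the complement of [A] is at most [Q], whose expectation is
    [c tr (S^-1 S) = c n]. Taking any [c >= 0], rather than a positive radius,
    makes the bound uniform in the dimension: for [n = 0] it is applied with
    [c = 0]. *)
Lemma multivariate_chebyshev {R : realType} {d : measure_display}
    {T : measurableType d} {P : probability T R} {n : nat}
    {X : T -> 'cV[R]_n} {mu : 'cV[R]_n} {S : 'M[R]_n} (c : R) (A : set T) :
    has_mean P X mu -> has_cov P X S -> S \in unitmx -> 0 <= c ->
    measurable A ->
    (forall t, ellipsoid (c *: invmx S) (X t - mu) -> A t) ->
  ((1 - c * n%:R)%:E <= P A)%E.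
Proof.
move=> meanX covX Sunit c_ge0 mA ellA.
have [L1Q EQ] := expectation_centered_form (c *: invmx S) meanX covX.
set Q := centered_form _ _ _ in L1Q EQ.
have Q_ge0 t : 0 <= Q t.
  rewrite /Q /centered_form -scalemxAr -scalemxAl mxE.
  by rewrite mulr_ge0// (invmx_cov_psd _ meanX covX).
have {}EQ : ('E_P[Q] = (c * n%:R)%:E)%E.
  by rewrite EQ -scalemxAl mulVmx// mxtraceZ mxtrace1.
have mQ : measurable_fun setT Q.
  by move: L1Q => /[!inE] /andP[/[!inE]].
have PAC : (P (~` A) <= 'E_P[Q])%E.
  rewrite -(expectation_indic P (measurableC mA)); apply: expectation_le => //.
    exact/measurable_indic/measurableC.
  apply/aeW => t /=; rewrite indicE; case: (boolP (t \in _)) => // /set_mem nAt.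
  by rewrite leNgt; apply/negP => /ltW; move/ellA.
rewrite -[A]setCK probability_setC; last exact: measurableC.
by rewrite EFinB leeB// -EQ.
Qed.

Lemma periodic_modn {T : Type} {N : nat} {f : nat -> T} (k : nat) :
  periodic_seq N f -> f (k %% N)%N = f k.
Proof.
move=> perf; rewrite [in RHS](divn_eq k N) addnC.
elim: (k %/ N)%N => [|q IHq]; first by rewrite addn0.
by rewrite mulSn addnCA addnC perf.
Qed.

Theorem mainTheorem4 (R : realType) (nx m p : nat)
    (A : 'M[R]_nx) (B : 'M[R]_(nx, m)) (C : 'M[R]_(p, nx))
    (K : 'M[R]_(m, nx)) (L : 'M[R]_(nx, p)) (uT : 'cV[R]_m)
    (Sw : 'M[R]_nx) (Snu : 'M[R]_p)
    (d : measure_display) (T : measurableType d) (P : probability T R)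
    (w : nat -> {RV P >-> borel_cV R nx}) (nu : nat -> {RV P >-> borel_cV R p})
    (w_mean : forall k, has_mean P (w k) 0)
    (nu_mean : forall k, has_mean P (nu k) 0)
    (w_cov : forall k, has_cov P (w k) Sw)
    (nu_cov : forall k, has_cov P (nu k) Snu)
    (w_id : identically_distributed w)
    (nu_id : identically_distributed nu)
    (w_nu_indep : independent_noises w nu)
    (N : nat) (N_gt0 : (0 < N)%N)
    (eta : nat -> bool) (eta_periodic : periodic_seq N eta)
    (x e : nat -> {RV P >-> borel_cV R nx})
    (x_e_dyn : closed_loop A B C K L uT eta w nu x e)
    (rho_Abar : spectral_radius (monodromy (Abar A B K eta) N) < 1)
    (rho_Atilde : spectral_radius (monodromy (Atilde A L C eta) N) < 1)
    (X : set 'cV[R]_nx) (mX : measurable (X : set (borel_cV R nx)))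
    (delta : R) (delta_gt0 : 0 < delta) (delta_lt1 : delta < 1)
    (mus : nat -> 'cV[R]_nx) (mus_steady : steady_mean A B K uT N eta mus)
    (Pbs : nat -> 'M[R]_(nx + nx))
    (Pbs_steady : steady_joint_cov A B C K L Sw Snu N eta Pbs)
    (Pxs_unit : forall k, state_cov Pbs k \in unitmx) :
  let alpha := Num.sqrt (nx%:R / delta) in
  (forall k, (k < N)%N ->
     pontryagin_diff X
       (ellipsoid ((alpha ^+ 2)^-1 *: invmx (state_cov Pbs k))) (mus k)) ->
  forall kstar : nat,
  (forall k, (kstar <= k)%N ->
     has_mean P (x k) (mus k) /\ has_cov P (x k) (state_cov Pbs k)) ->
  forall k, (kstar <= k)%N -> ((1 - delta)%:E <= P (x k @^-1` X))%E.
Proof.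
move=> alpha mus_in kstar steady k lek.
have [meanx covx] := steady k lek.
have alphaV_ge0 : 0 <= (alpha ^+ 2)^-1 by rewrite invr_ge0 sqr_ge0.
have mxkX : measurable (x k @^-1` X).
  by rewrite -[_ @^-1` _]setTI; exact: (measurable_funPT (x k)).
have cheb := multivariate_chebyshev _ _ meanx covx (Pxs_unit k) alphaV_ge0 mxkX.
apply: le_trans (cheb _); last first.
  move=> t xt_in /=; rewrite -[x k t](subrKC (mus k)).
  have := mus_in (k %% N)%N (ltn_pmod k N_gt0).
  have -> : state_cov Pbs (k %% N) = state_cov Pbs k.
    by rewrite /state_cov (periodic_modn k (proj1 Pbs_steady)).
  by rewrite (periodic_modn k (proj1 mus_steady)) => Xmu; exact: Xmu.
rewrite lee_fin lerB// sqr_sqrtr; last by rewrite divr_ge0 ?ler0n// ltW.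
(* It remains to see that [(nx / delta)^-1 * nx <= delta]. For [nx = 0] the
   left-hand side is 0, the inverse of 0 being 0; otherwise equality holds. *)
have [->|nx_neq0] := eqVneq (nx%:R : R) 0; first by rewrite mulr0 ltW.
by rewrite invf_div divfK.
Qed.
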